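(* Let $q\ge 0$ be an integer, let $\theta_0=1$, $\theta_1,\dots,\theta_q\in\mathbb{R}$, $\theta=(\theta_0,\dots,\theta_q)'$, and let $\{X_t\}$ be the MA(q) process $X_t=\sum_{j=0}^q\theta_j e_{t-j}$, where $\{e_t\}_{t\in\mathbb{Z}}$ is i.i.d. with $e_t\sim S^0_\alpha(\beta^{(0)},\gamma^{(0)},\delta^{(0)})$. Suppose that either (A1) $\beta^{(0)}=0$, or (A2) $\sum_{j=0}^{i}\theta_j\ge 0$ for $i=0,\dots,q-1$ and $\sum_{j=i}^{q}\theta_j\ge0$ for $i=1,\dots,q$. Let $0<p_1<p_2<1$, and for real $r>0$ with $r\ge q$ let $\zeta^{(r)}_{p_1,p_2}$ be given by $$\zeta^{(r)}_{p_1,p_2}=\alpha^{-1}\ln\Big(r\Big|\sum_{i=0}^{q}\theta_i\Big|^\alpha+g_\alpha(\theta)\Big)+\zeta^{(0)}_{p_1,p_2},$$ $$g_\alpha(\theta)=\sum_{i=0}^{q-1}\Big|\sum_{j=0}^{i}\theta_j\Big|^\alpha-q\Big|\sum_{i=0}^{q}\theta_i\Big|^\alpha+\sum_{i=1}^{q}\Big|\sum_{j=i}^{q}\theta_j\Big|^\alpha .$$ Then $$\lim_{r\to\infty}\frac{\partial}{\partial\ln r}\zeta^{(r)}_{p_1,p_2}=\alpha^{-1}.$$ For $r\ge q$, $$\operatorname{sign}\Big(\frac{\partial^2}{(\partial\ln r)^2}\zeta^{(r)}_{p_1,p_2}\Big)=\operatorname{sign}\big(g_\alpha(\theta)\big),$$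 and therefore: if $g_\alpha(\theta)>0$ then $\zeta^{(r)}_{p_1,p_2}$ is convex in $\ln r$; if $g_\alpha(\theta)=0$ then $\zeta^{(r)}_{p_1,p_2}$ is linear in $\ln r$; if $g_\alpha(\theta)<0$ then $\zeta^{(r)}_{p_1,p_2}$ is concave in $\ln r$.
   Context: $S^0_\alpha(\beta,\gamma,\delta)$ denotes the stable distribution in Nolan's $S^0$ parameterisation, with stability $\alpha\in(0,2]$, skewness $\beta\in[-1,1]$, scale $\gamma>0$ and location $\delta\in\mathbb{R}$: $Y\sim S^0_\alpha(\beta,\gamma,\delta)$ iff for all $u\in\mathbb{R}$ (value $1$ at $u=0$), $$E e^{iuY}=\exp\big(-\gamma^\alpha|u|^\alpha[1+i\beta\tan(\pi\alpha/2)\operatorname{sign}(u)((\gamma|u|)^{1-\alpha}-1)]+i\delta u\big)\quad\text{if }\alpha\neq1,$$ $$E e^{iuY}=\exp\big(-\gamma|u|[1+i\beta\tfrac{2}{\pi}\operatorname{sign}(u)\ln(\gamma|u|)]+i\delta u\big)\quad\text{if }\alpha=1.$$ For a random variable with $p$th quantile $\xi_p$, the log quantile difference at levels $0<p_1<p_2<1$ is $\zeta_{p_1,p_2}=\ln(\xi_{p_2}-\xi_{p_1})$. Here $\zeta^{(0)}_{p_1,p_2}$ is the log quantile difference of $e_t$, a finite real constant not depending on $r$ (stable distributions have positive density at their quantiles). For integer $r\ge1$ with $r\ge q$, under (A1) or (A2), the displayed formula equals the log quantile difference of the temporal aggregation $S^{(r)}_t=\sum_{i=0}^{r-1}X_{t-i}$;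 for other real $r$ it is taken as the definition of $\zeta^{(r)}_{p_1,p_2}$, and derivatives are those of this formula regarded as a function of the real variable $\ln r$.
   Formalization: The limit and the second-derivative sign identity are stated only for θ_0+…+θ_q ≠ 0; if this sum is 0 (e.g. q=1, θ_1=−1), ζ^(r) is constant in r while g_α(θ)>0, so both claims fail. The convexity, linearity and concavity claims need no such assumption. *)

(* Defs.v *)
(* MathComp-Analysis, over an arbitrary R : realType. *)
From HB Require Import structures.
From mathcomp Require Export all_boot all_order all_algebra finmap.
From mathcomp Require Export all_classical all_reals all_analysis.
From mathcomp Require Export complex.
Export Order.TTheory GRing.Theory Num.Theory numFieldNormedType.Exports.

Set Implicit Arguments.
Unset Strict Implicit.
Unset Printing Implicit Defensive.

#[export] Set Implicit Arguments.
#[export] Unset Strict Implicit.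
#[export] Unset Printing Implicit Defensive.

Local Open Scope classical_set_scope.
Local Open Scope ring_scope.

Section Probability.
Context {d : measure_display} {T : measurableType d} {R : realType}.
Context {P : probability T R}.
Local Open Scope ereal_scope.

Definition mutually_independent (e : int -> {RV P >-> R}) : Prop :=
  forall (s : {fset int}) (A : int -> set R), (forall i, measurable (A i)) ->
    P (\bigcap_(i in [set` s]) (e i @^-1` A i)) =
    \prod_(i <- s) P (e i @^-1` A i).

Definition identically_distributed (e : int -> {RV P >-> R}) : Prop :=
  forall (s t : int) (A : set R), measurable A ->
    distribution P (e s) A = distribution P (e t) A.

Definition iid (e : int -> {RV P >-> R}) : Prop :=
  mutually_independent e /\ identically_distributed e.

(* E exp(iuY), by real and imaginary parts; both expectations are of bounded
   random variables, so that [fine] loses nothing. *)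
Definition char_fun (Y : {RV P >-> R}) (u : R) : R[i] :=
  Complex (fine 'E_P[fun w => cos (u * Y w)%R])
          (fine 'E_P[fun w => sin (u * Y w)%R]).

Definition quantile (Y : {RV P >-> R}) (p : R) : R :=
  inf [set x : R | p%:E <= cdf Y x].

Definition log_quantile_difference (Y : {RV P >-> R}) (p1 p2 : R) : R :=
  ln (quantile Y p2 - quantile Y p1)%R.

End Probability.

Section Stable.
Context {R : realType}.
Local Open Scope complex_scope.

Definition cexp (z : R[i]) : R[i] :=
  let: a +i* b := z in (expR a)%:C * (cos b +i* sin b).

(* No special case is needed at u = 0: the factor |u|^alpha (resp. |u|) is 0
   there, and [powR] and [ln] are total, so the exponent vanishes; see
   [stable_cf0]. *)
Definition stable_cf (alpha beta gamma delta u : R) : R[i] :=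
  cexp (if alpha == 1 then
          - (gamma * `|u|)%:C
            * (1 + 'i * (beta * (2 / pi) * Num.sg u * ln (gamma * `|u|))%:C)
          + 'i * (delta * u)%:C
        else
          - (gamma `^ alpha * `|u| `^ alpha)%:C
            * (1 + 'i * (beta * tan (pi * alpha / 2) * Num.sg u
                         * ((gamma * `|u|) `^ (1 - alpha) - 1))%:C)
          + 'i * (delta * u)%:C).

Lemma stable_cf0 (alpha beta gamma delta : R) : 0 < alpha ->
  stable_cf alpha beta gamma delta 0 = 1.
Proof.
move=> a0; have a_neq0 : alpha != 0 by rewrite gt_eqF.
rewrite /stable_cf normr0 !mulr0 (@powR0 _ alpha)// mulr0.
rewrite !(oppr0, mul0r, mulr0, addr0) if_same /cexp /= expR0 cos0 sin0.
by rewrite mul1r.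
Qed.

Definition stable_S0 {d : measure_display} {T : measurableType d}
    {P : probability T R} (alpha beta gamma delta : R)
    (Y : {RV P >-> R}) : Prop :=
  forall u : R, char_fun Y u = stable_cf alpha beta gamma delta u.

End Stable.

Section MovingAverage.
Context {R : realType} {q : nat}.
Implicit Type theta : 'I_q.+1 -> R.

Definition MA_process {d : measure_display} {T : measurableType d}
    {P : probability T R} theta (e X : int -> {RV P >-> R}) : Prop :=
  forall (t : int) (w : T),
    X t w = \sum_(j < q.+1) theta j * e (t - j%:Z) w.

Definition total_sum theta : R := \sum_(j < q.+1) theta j.
Definition head_sum theta (i : nat) : R := \sum_(j < q.+1 | (j <= i)%N) theta j.
Definition tail_sum theta (i : nat) : R := \sum_(j < q.+1 | (i <= j)%N) theta j.

Definition partial_sums_nonneg theta : Prop :=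
  (forall i : nat, (i < q)%N -> 0 <= head_sum theta i) /\
  (forall i : nat, (1 <= i <= q)%N -> 0 <= tail_sum theta i).

Definition g_fun (alpha : R) theta : R :=
  \sum_(0 <= i < q) `|head_sum theta i| `^ alpha
  - q%:R * `|total_sum theta| `^ alpha
  + \sum_(1 <= i < q.+1) `|tail_sum theta i| `^ alpha.

Definition zeta (alpha : R) theta (zeta0 r : R) : R :=
  alpha^-1 * ln (r * `|total_sum theta| `^ alpha + g_fun alpha theta) + zeta0.

(* zeta as a function of x = ln r. *)
Definition zeta_of_ln (alpha : R) theta (zeta0 x : R) : R :=
  zeta alpha theta zeta0 (expR x).

End MovingAverage.

Section Shape.
Context {R : realType}.

Definition concave_function (D : set R) (f : R -> R) : Prop :=
  @convex_function R R^o D (fun x => - f x).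

Definition affine_on (D : set R) (f : R -> R) : Prop :=
  exists a b : R, forall x, D x -> f x = a * x + b.

End Shape.

(* Main.v *)
(* Put x = ln r, A = |sum theta|^alpha and D(x) = A e^x + g, so that zeta is
   ln D / alpha + const, with derivatives (1 - g / D) / alpha and
   g A e^x / (alpha D^2).  On the domain D > 0: r A + g is (r - q) A plus
   nonnegative powers, among them |theta_0|^alpha = 1 (and D = r when q = 0).
   Convexity and concavity come from tangent lines, which also covers A = 0 and
   the end point r = q: D(x) / D(m) = p e^(x - m) + (1 - p) with
   p = A e^m / D(m), and concavity of ln compares the logarithm of this with
   p (x - m), from above when 0 <= p <= 1 (g >= 0) and from below when
   p >= 1 (g <= 0). *)
Require Import Defs.
From mathcomp Require Import ring lra.

Local Open Scope classical_set_scope.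
Local Open Scope ring_scope.

Section LnAffineExp.
Context {R : realType}.
Implicit Types A k c g x : R.

Lemma near_affine_expR_gt0 A g x :
  0 < expR x * A + g -> \near x, 0 < expR x * A + g.
Proof.
have cD : continuous (fun z => expR z * A + g).
  move=> z; apply: cvgD; last exact: cvg_cst.
  by apply: cvgM; [exact: continuous_expR | exact: cvg_cst].
by move=> Dx; apply: (@cvgr_gt _ _ _ _ _ _ (cD x)).
Qed.

Lemma is_derive_affine_expR A g x :
  is_derive x 1 (fun z => expR z * A + g) (expR x * A).
Proof.
have -> : (fun z => expR z * A + g) = (A \*: expR) + cst g.
  by apply/funext => z /=; rewrite !fctE /= [A *: _]mulrC.
by apply: is_derive_eq; rewrite addr0 [A *: _]mulrC.
Qed.

(** Writing [expR x * A / D] as [1 - g / D] leaves [x] only in the denominator, which gives both the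
    limit at infinity and the second derivative. *)
Lemma is_derive_ln_affine_expR k A g c x : 0 < expR x * A + g ->
  is_derive x 1 (fun z => k * ln (expR z * A + g) + c)
    (k * (1 - g / (expR x * A + g))).
Proof.
move=> Dx.
have -> : (fun z => k * ln (expR z * A + g) + c) =
    (k \*: (@ln R \o (fun z => expR z * A + g))) + cst c by [].
have dD := is_derive_affine_expR A g x.
have dln := is_derive1_ln Dx.
rewrite (_ : 1 - _ = (expR x * A + g)^-1 * (expR x * A)).
  by apply: is_derive_eq; rewrite addr0.
by field; rewrite gt_eqF.
Qed.

Lemma is_derive2_ln_affine_expR k A g c x : 0 < expR x * A + g ->
  is_derive x 1 (derive1 (fun z => k * ln (expR z * A + g) + c))
    (k * (g * (expR x * A) / (expR x * A + g) ^+ 2)).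
Proof.
move=> Dx.
(* The closed form of the first derivative is available only where [D > 0]; this condition is open,
   so it holds near [x], enough to differentiate there. *)
apply: (@near_eq_is_derive _ _ _ (fun z => k * (1 - g / (expR z * A + g)))).
  near=> z; rewrite derive1E.
  have Dz : 0 < expR z * A + g.
    by near: z; exact: near_affine_expR_gt0.
  by have dz := is_derive_ln_affine_expR k c Dz; rewrite derive_val.
have -> : (fun z => k * (1 - g / (expR z * A + g))) =
    k \*: (cst 1 - g \*: (fun z => (expR z * A + g)^-1)) by [].
have dD := is_derive_affine_expR A g x.
have dV := @is_deriveV _ (fun z => expR z * A + g) x _ _ (lt0r_neq0 Dx) dD.
rewrite (_ : k * (g * _ / _) =
    k * (0 - g * (- (expR x * A + g) ^- 2 * (expR x * A)))).
  exact: is_derive_eq.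
by field; rewrite gt_eqF.
Unshelve. all: by end_near. Qed.

(** Concavity of [ln] at the points [expR y] and [1], with weights [p] and [1 - p]. *)
Lemma ln_weighted_expR_ge (p y : R) : 0 <= p -> p <= 1 ->
  p * y <= ln (p * expR y + (1 - p)).
Proof.
move=> p0 p1; have := concave_ln (Itv01 p0 p1) (expR_gt0 y) (@ltr01 R).
by rewrite !convRE /= /unstable.onem expRK ln1 !mulr0 addr0 mulr1.
Qed.

(** With [w = p * expR y + (1 - p)], solving for [expR y] gives the average of [w] and [1] with
    weights [p^-1] and [1 - p^-1]. The previous bound then applies with [p^-1] and [ln w]. *)
Lemma ln_weighted_expR_le (p y : R) : 1 <= p -> 0 < p * expR y + (1 - p) ->
  ln (p * expR y + (1 - p)) <= p * y.
Proof.
move=> p1 w0; have p0 : 0 < p by lra.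
have [i0 i1] : 0 <= p^-1 /\ p^-1 <= 1 by rewrite invr_ge0 ltW// invf_le1.
have := ln_weighted_expR_ge (ln (p * expR y + (1 - p))) i0 i1.
rewrite lnK ?posrE// (_ : p^-1 * _ + _ = expR y); last by field; rewrite gt_eqF.
by rewrite expRK ler_pdivrMl.
Qed.

Lemma affine_expR_quotient A g m x : 0 < expR m * A + g ->
  let p := expR m * A / (expR m * A + g) in
  expR x * A + g = (expR m * A + g) * (p * expR (x - m) + (1 - p)).
Proof.
move=> Dm /=; have -> : expR x = expR m * expR (x - m).
  by rewrite -expRD addrC subrK.
by field; rewrite gt_eqF.
Qed.

Lemma ln_affine_expR_ge_tangent A g m x : 0 <= A -> 0 <= g ->
    0 < expR m * A + g -> 0 < expR x * A + g ->
  ln (expR m * A + g) + expR m * A / (expR m * A + g) * (x - m)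
    <= ln (expR x * A + g).
Proof.
move=> A0 g0 Dm Dx; have EA0 : 0 <= expR m * A by rewrite mulr_ge0 ?expR_ge0.
rewrite (affine_expR_quotient x Dm) in Dx *; rewrite pmulr_rgt0 // in Dx.
rewrite lnM ?posrE // lerD2l ln_weighted_expR_ge //.
  by rewrite divr_ge0 // ltW.
by rewrite ler_pdivrMr // mul1r lerDl.
Qed.

Lemma ln_affine_expR_le_tangent A g m x : g <= 0 ->
    0 < expR m * A + g -> 0 < expR x * A + g ->
  ln (expR x * A + g) <=
    ln (expR m * A + g) + expR m * A / (expR m * A + g) * (x - m).
Proof.
move=> g0 Dm Dx.
rewrite (affine_expR_quotient x Dm) in Dx *; rewrite pmulr_rgt0 // in Dx.
rewrite lnM ?posrE // lerD2l ln_weighted_expR_le //.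
by rewrite ler_pdivlMr // mul1r gerDl.
Qed.

(** Averaging the supporting line at the weighted mean [m] over [x] and [y] returns [f m], because
    [t (x - m) + (1 - t) (y - m) = 0]. *)
Lemma convex_of_tangents (D : set R) (f : R -> R) :
    (forall x y (t : {i01 R}), D x -> D y ->
       exists s, forall z, D z ->
         f (t%:num * x + (1 - t%:num) * y) +
           s * (z - (t%:num * x + (1 - t%:num) * y)) <= f z) ->
  @convex_function R R^o D f.
Proof.
move=> tg t x y /set_mem Dx /set_mem Dy.
have [s tgs] := tg x y t Dx Dy.
rewrite !convRE /unstable.onem; set m := _ + _ in tgs *.
apply: (@le_trans _ _ (t%:num * (f m + s * (x - m)) +
                       (1 - t%:num) * (f m + s * (y - m)))).
  by rewrite le_eqVlt; apply/orP; left; apply/eqP; rewrite /m; ring.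
by apply: lerD; apply: ler_wpM2l; rewrite ?ge0 ?subr_ge0 ?le1 //; exact: tgs.
Qed.

Lemma cvg_affine_inv A g : 0 < A -> (r * A + g)^-1 @[r --> +oo] --> (0 : R).
Proof.
move=> A0.
have cy : r * A + g @[r --> +oo] --> +oo.
  have cyA : r * A @[r --> +oo] --> +oo.
    by apply: gt0_cvgMly => //; exact: cvg_id.
  exact: (cvg_comp _ _ cyA (cvg_addrr g)).
apply/gtr0_cvgV0 => //; near=> r.
have -> : (0 < r * A + g) = (- g / A < r).
  by rewrite ltr_pdivrMr // -[RHS]subr_gt0 opprK.
by near: r; exact: nbhs_pinfty_gt (num_real _).
Unshelve. all: by end_near. Qed.

End LnAffineExp.

Section Aggregation.
Context {R : realType} {q : nat}.
Implicit Types (theta : 'I_q.+1 -> R) (alpha r : R).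

(** This identifies the first term of [g_fun] when [q > 0], and the total sum itself when
    [q = 0]. *)
Lemma head_sum0 theta : head_sum theta 0 = theta ord0.
Proof.
rewrite /head_sum (bigD1 ord0) //= big1 ?addr0 // => j /andP[].
by rewrite leqn0 => /eqP j0 /eqP[]; exact: val_inj.
Qed.

Lemma aggregated_scale_gt0 alpha theta r : theta ord0 = 1 ->
  0 < r -> q%:R <= r -> 0 < r * `|total_sum theta| `^ alpha + g_fun alpha theta.
Proof.
move=> th0 r0 qr; rewrite /g_fun.
set A := _ `^ _; set H := \sum_(0 <= i < q) _; set U := \sum_(1 <= i < _) _.
have -> : r * A + (H - q%:R * A + U) = (r - q%:R) * A + (H + U) by ring.
have A0 : 0 <= A by exact: powR_ge0.
have U0 : 0 <= U by apply: sumr_ge0 => i _; exact: powR_ge0.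
have rqA : 0 <= (r - q%:R) * A by rewrite mulr_ge0 // subr_ge0.
have [q0|q0] := posnP q.
  (* For [q = 0] the sum [H] is empty, so strict positivity has to come from [A = 1] and [0 < r]. *)
  have H0 : 0 <= H by apply: sumr_ge0 => i _; exact: powR_ge0.
  have AE : A = 1.
    rewrite /A (_ : total_sum theta = 1) ?normr1 ?powR1 //.
    rewrite -th0 -head_sum0; apply: eq_bigl => -[j /= jq].
    by move: jq; rewrite q0 ltnS => ->.
  by rewrite ltr_wpDr ?addr_ge0 // AE mulr1 q0 subr0.
rewrite ltr_wpDl // ltr_wpDr // /H big_ltn // head_sum0 th0 normr1 powR1.
by rewrite ltr_pwDl // sumr_ge0 // => i _; exact: powR_ge0.
Qed.

End Aggregation.

Theorem corollary4 (R : realType) (d : measure_display) (T : measurableType d)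
  (P : probability T R) (alpha beta0 gamma0 delta0 : R)
  (q : nat) (theta : 'I_q.+1 -> R) (e X : int -> {RV P >-> R})
  (p1 p2 : R) (t : int)
  (alpha_gt0 : 0 < alpha) (alpha_le2 : alpha <= 2)
  (beta_ge : -1 <= beta0) (beta_le : beta0 <= 1) (gamma_gt0 : 0 < gamma0)
  (theta0 : theta ord0 = 1)
  (e_iid : iid e)
  (e_stable : forall s, stable_S0 alpha beta0 gamma0 delta0 (e s))
  (X_MA : MA_process theta e X)
  (A1_or_A2 : beta0 = 0 \/ partial_sums_nonneg theta)
  (p1_gt0 : 0 < p1) (p1_lt_p2 : p1 < p2) (p2_lt1 : p2 < 1) :
  let zeta0 := log_quantile_difference (e t) p1 p2 in
  let F := zeta_of_ln alpha theta zeta0 in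
  let g := g_fun alpha theta in
  let dom := [set r : R | 0 < r /\ q%:R <= r] in
  let lndom := [set ln r | r in dom] in
  [/\ forall r, dom r -> derivable F (ln r) 1 /\ derivable (derive1 F) (ln r) 1,
      total_sum theta != 0 -> derive1 F (ln r) @[r --> +oo] --> alpha^-1,
      total_sum theta != 0 ->
        forall r, dom r -> Num.sg (derive1n 2 F (ln r)) = Num.sg g &
      [/\ 0 < g -> @convex_function R R^o lndom F,
          g = 0 -> affine_on lndom F &
          g < 0 -> concave_function lndom F] ].
Proof.
move=> zeta0 F g dom lndom.
set A := `|total_sum theta| `^ alpha.
have A0 : 0 <= A by exact: powR_ge0.
have FE : F = (fun x => alpha^-1 * ln (expR x * A + g) + zeta0) by [].
have Dgt0 r : dom r -> 0 < r * A + g.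
  by case=> r0 qr; exact: aggregated_scale_gt0.
have Dln r : dom r -> 0 < expR (ln r) * A + g.
  by move=> dr; rewrite lnK ?posrE; [exact: Dgt0 | case: dr].
have lndomD x : lndom x -> 0 < expR x * A + g by case=> r dr <-; exact: Dln.
(* Tangents are taken at convex combinations, where [D > 0] is known once they lie in [lndom]; this
   set is the up-closed set [q <= expR z]. *)
have lndom_conv x y (t' : {i01 R}) :
    lndom x -> lndom y -> lndom (t'%:num * x + (1 - t'%:num) * y).
  have lndomE z : lndom z <-> q%:R <= expR z.
    split; first by case=> r [r0 qr] <-; rewrite lnK ?posrE.
    by move=> qz; exists (expR z); [split=> //; exact: expR_gt0 | exact: expRK].
  rewrite !lndomE => qx qy; have [xy|/ltW yx] := leP x y.
    apply: (le_trans qx); rewrite ler_expR -subr_ge0.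
    rewrite (_ : _ - _ = (1 - t'%:num) * (y - x)); last by ring.
    by rewrite mulr_ge0 ?subr_ge0 ?le1.
  apply: (le_trans qy); rewrite ler_expR -subr_ge0.
  rewrite (_ : _ - _ = t'%:num * (x - y)); last by ring.
  by rewrite mulr_ge0 ?subr_ge0.
have lnconv x y t' lx ly := lndomD _ (@lndom_conv x y t' lx ly).
have iA0 : 0 < alpha^-1 by rewrite invr_gt0.
(* If the total sum were zero, [F] would be constant and both the limit and the sign would be 0. *)
have A_gt0 : total_sum theta != 0 -> 0 < A.
  by move=> S0; rewrite powR_gt0 // normr_gt0.
split.
- move=> r /Dln Dr; rewrite FE; split; apply: ex_derive.
    exact: is_derive_ln_affine_expR.
  exact: is_derive2_ln_affine_expR.
- move=> /A_gt0 {}A_gt0.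
  apply: (@cvg_trans _ (alpha^-1 * (1 - g * (r * A + g)^-1) @[r --> +oo])).
    apply: near_eq_cvg; near=> r.
    have dr : dom r.
      by split; near: r; [exact: nbhs_pinfty_gt (num_real _) | exact: nbhs_pinfty_ge (num_real _)].
    have dF := is_derive_ln_affine_expR alpha^-1 zeta0 (Dln r dr).
    by rewrite derive1E FE derive_val lnK ?posrE //; case: dr.
  have cF : alpha^-1 * (1 - g * (r * A + g)^-1) @[r --> +oo] -->
      alpha^-1 * (1 - g * 0).
    apply: cvgM; first exact: cvg_cst.
    apply: cvgB; first exact: cvg_cst.
    by apply: cvgM; [exact: cvg_cst | exact: cvg_affine_inv].
  by rewrite mulr0 subr0 mulr1 in cF.
- move=> /A_gt0 {}A_gt0 r dr; have Dr := Dln r dr.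
  have d2F := is_derive2_ln_affine_expR alpha^-1 zeta0 Dr.
  (* Pull [g] to the front; the remaining factor is positive. *)
  rewrite /derive1n /= derive1E FE derive_val -mulrA mulrCA sgrM.
  rewrite [X in _ * X]gtr0_sg ?mulr1 // mulr_gt0 // divr_gt0 ?exprn_gt0 //.
  by rewrite mulr_gt0 ?expR_gt0.
split.
- move=> g0; apply: convex_of_tangents => x y t' lx ly.
  (* The slope is the derivative of [F] at the weighted mean. *)
  exists (alpha^-1 * (expR (t'%:num * x + (1 - t'%:num) * y) * A /
                    (expR (t'%:num * x + (1 - t'%:num) * y) * A + g))) => z lz.
  have tgt := ln_affine_expR_ge_tangent A0 (ltW g0) (lnconv _ _ _ lx ly)
    (lndomD _ lz).
  by rewrite FE addrAC lerD2r -(mulrA alpha^-1 _ (z - _)) -mulrDr ler_pM2l.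
- move=> g0.
  (* With [g = 0], positivity of [D = r * A] at a point of the domain forces [A > 0], so [ln D]
     splits as [x + ln A]. *)
  have AneN r : dom r -> 0 < A.
    by move=> dr; have := Dgt0 r dr; rewrite g0 addr0 pmulr_rgt0 //; case: dr.
  exists alpha^-1, (alpha^-1 * ln A + zeta0) => x [r dr <-].
  rewrite FE g0 addr0 lnM ?posrE ?expR_gt0 ?(AneN r) // expRK mulrDr addrA //.
- move=> g0; apply: convex_of_tangents => x y t' lx ly.
  (* The sign is reversed because concavity is stated as convexity of [- F]. *)
  exists (- (alpha^-1 * (expR (t'%:num * x + (1 - t'%:num) * y) * A /
                    (expR (t'%:num * x + (1 - t'%:num) * y) * A + g)))) => z lz.
  have tgt := ln_affine_expR_le_tangent (ltW g0) (lnconv _ _ _ lx ly)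
    (lndomD _ lz).
  rewrite mulNr -opprD lerN2.
  by rewrite FE addrAC lerD2r -(mulrA alpha^-1 _ (z - _)) -mulrDr ler_pM2l.
Unshelve. all: by end_near. Qed.
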